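(* Let $\xi,\eta\in \mathrm{c}_{\mathrm{o}}^*$ and $\xi\prec\eta$. (i) There is a $\zeta\in \mathrm{c}_{\mathrm{o}}^*$ for which $\xi\preccurlyeq\zeta\le\eta$. (ii) There is a $\rho\in \mathrm{c}_{\mathrm{o}}^*$ for which $\xi\le\rho\preccurlyeq\eta$.
   Context: $\mathrm{c}_{\mathrm{o}}^*$ denotes the cone of nonnegative monotone nonincreasing sequences converging to $0$ (not a dual space). For $\xi,\eta\in \mathrm{c}_{\mathrm{o}}^*$: $\xi\prec\eta$ means $\sum_{j=1}^n\xi_j\le\sum_{j=1}^n\eta_j$ for every $n\in\mathbb N$; $\xi\preccurlyeq\eta$ (strong majorization) means $\xi\prec\eta$ and $\liminf_n\sum_{j=1}^n(\eta_j-\xi_j)=0$; $\xi\le\eta$ means $\xi_n\le\eta_n$ for every $n$. *)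

(* Defs.v *)
From mathcomp Require Import all_boot all_order all_algebra.
From mathcomp Require Import all_classical all_reals all_analysis.

Set Implicit Arguments.
Unset Strict Implicit.
Unset Printing Implicit Defensive.

Import Order.TTheory GRing.Theory Num.Theory.
Import numFieldNormedType.Exports.

Local Open Scope classical_set_scope.
Local Open Scope ring_scope.

(* Sequences are indexed from 0, so u j stands for the (j+1)-th term and
   \sum_(0 <= j < n) u j is the sum of the first n terms. *)

Definition co_star (R : realType) : set (R^nat) :=
  [set u : R^nat | [/\ forall n, 0 <= u n, nonincreasing_seq u & u @ \oo --> (0 : R)]].

Definition majorized (R : realType) (xi eta : R^nat) : Prop :=
  forall n : nat, \sum_(0 <= j < n) xi j <= \sum_(0 <= j < n) eta j.

(* The inferior limit is taken in \bar R: the partial sums of eta - xi may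
   diverge to +oo, in which case the real-valued limn_inf is meaningless. *)
Definition strongly_majorized (R : realType) (xi eta : R^nat) : Prop :=
  majorized xi eta /\
  limn_einf (fun n => (\sum_(0 <= j < n) (eta j - xi j))%:E) = 0%E.

(* Main.v *)
(* Zorn's lemma provides a pointwise minimal zeta among the nonnegative
   nonincreasing sequences with xi majorized by zeta and zeta <= eta, and a
   pointwise maximal rho among the nonincreasing sequences with xi <= rho
   majorized by eta.  If the partial-sum gap stayed above some e > 0 from some
   point on, a single term of zeta could be lowered where zeta drops, or a
   single term of rho raised just after rho drops (or its first term).  If
   there is no late drop then the sequence eventually vanishes, and the gap
   stays positive as the starting point moves down, until the empty sum gives a
   contradiction. *)
Require Import Defs.
From mathcomp Require Import all_boot all_order all_algebra.
From mathcomp Require Import all_classical all_reals all_analysis.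
From mathcomp Require Import lra.

Set Implicit Arguments.
Unset Strict Implicit.
Unset Printing Implicit Defensive.

Import Order.TTheory GRing.Theory Num.Theory.
Import numFieldNormedType.Exports.

Local Open Scope classical_set_scope.
Local Open Scope ring_scope.

(** * Extremal elements of pointwise closed sets of sequences *)

Definition ptws_seq_closed (R : realType) (P : set (R^nat)) : Prop :=
  forall (w : nat -> R^nat) (v : R^nat),
    (forall k, P (w k)) -> (forall j, w k j @[k --> \oo] --> v j) -> P v.

(** Of two comparable members of the chain, the larger inherits what either achieves, so
    approximations of finitely many coordinate suprema merge into one member. *)
Lemma chain_near_sup (R : realType) (A : set (R^nat)) (b : R^nat) :
  A !=set0 -> (forall u, A u -> forall j, u j <= b j) ->
  total_on A (fun u v => forall j, u j <= v j) ->
  forall (e : R) n, 0 < e ->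
  exists2 u, A u & forall j, (j < n)%N -> sup [set a j | a in A] - e < u j.
Proof.
move=> [a Aa] Ab totA e n e0; elim: n => [|n [u Au ltu]]; first by exists a.
have supA : has_sup [set c n | c in A].
  split; first by exists (a n), a.
  by exists (b n) => _ [c Ac <-]; exact: Ab.
have [_ [c Ac <-] ltc] := sup_adherent e0 supA.
have [le|le] := totA u c Au Ac.
- exists c => // j; rewrite ltnS leq_eqVlt => /predU1P[->//|/ltu ltj].
  exact: lt_le_trans ltj _.
- exists u => // j; rewrite ltnS leq_eqVlt => /predU1P[->|/ltu//].
  exact: lt_le_trans ltc _.
Qed.

(** Zorn's lemma on the subtype of [P]. As there are only countably many coordinates, the
    coordinatewise supremum of a chain is the pointwise limit of a sequence from the chain, so
    closedness under sequences puts it in [P]. *)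
Lemma exists_maximal_seq (R : realType) (P : set (R^nat)) (b u0 : R^nat) :
  P u0 -> (forall u, P u -> forall j, u j <= b j) -> ptws_seq_closed P ->
  exists2 m, P m & forall u, P u -> (forall j, m j <= u j) -> u = m.
Proof.
move=> Pu0 Pb Pcl.
pose T := {u : R^nat | P u}.
pose leT (s t : T) : bool := `[< forall j, sval s j <= sval t j >].
have [| | | |[m Pm] mmax] := @Zorn T leT.
- by move=> t; apply/asboolP.
- move=> r s t /asboolP rs /asboolP st; apply/asboolP => j.
  exact: le_trans (rs j) (st j).
- move=> [s Ps] [t Pt] /asboolP st /asboolP ts.
  have ets : s = t by apply/funext => j; apply: le_anti; rewrite st ts.
  by case: _ / ets Pt {st ts} => Pt; rewrite (Prop_irrelevance Ps Pt).
- move=> A totA.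
  have [[t0 At0]|A0] := pselect (A !=set0); last first.
    by exists (exist _ u0 Pu0) => s As; case: A0; exists s.
  pose B := [set sval t | t in A].
  have BP u : B u -> P u by move=> [t _ <-]; exact: svalP.
  have Bb u : B u -> forall j, u j <= b j by move=> /BP; exact: Pb.
  have totB : total_on B (fun u v => forall j, u j <= v j).
    move=> _ _ [s As <-] [t At <-].
    by case: (totA s t As At) => /asboolP; [left|right].
  have B0 : B !=set0 by exists (sval t0), t0.
  pose v j := sup [set u j | u in B].
  have Bv u : B u -> forall j, u j <= v j.
    move=> Bu j; apply: ub_le_sup; last by exists u.
    by exists (b j) => _ [c Bc <-]; exact: Bb.
  (* Diagonal choice: [w k] is within 1/(k+1) of [v] at the first [k] coordinates, so each
     coordinate [j] is controlled once [k] exceeds [j]. *)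
  have [w wP] : {w : nat -> R^nat & forall k, B (w k) /\
      forall j, (j < k)%N -> v j - k.+1%:R^-1 < w k j}.
    apply: (@choice _ _ (fun k u => B u /\
      forall j, (j < k)%N -> v j - k.+1%:R^-1 < u j)) => k.
    have k0 : (0 : R) < k.+1%:R^-1 by rewrite invr_gt0.
    by have [u Bu ltu] := chain_near_sup B0 Bb totB k k0; exists u.
  suff Pv : P v.
    by exists (exist _ v Pv) => s As; apply/asboolP => j; apply: Bv; exists s.
  apply: (Pcl w) => [k|j]; first by apply: BP; case: (wP k).
  apply: (@squeeze_cvgr _ _ _ _ (fun k => v j - harmonic k) (fun=> v j)).
  + exists j.+1 => // k /= jk; have [Bw /(_ _ jk)/ltW ->] := wP k.
    by rewrite Bv.
  + rewrite -[X in _ --> X]subr0; apply: cvgB; first exact: cvg_cst.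
    exact: cvg_harmonic.
  + exact: cvg_cst.
- exists m => // u Pu mu.
  by have /(congr1 sval) := mmax (exist _ u Pu) (asboolT mu).
Qed.

Lemma exists_minimal_seq (R : realType) (P : set (R^nat)) (b u0 : R^nat) :
  P u0 -> (forall u, P u -> forall j, b j <= u j) -> ptws_seq_closed P ->
  exists2 m, P m & forall u, P u -> (forall j, u j <= m j) -> u = m.
Proof.
move=> Pu0 Pb Pcl.
have [|||m Pm mmax] :=
  @exists_maximal_seq R (fun u => P (fun j => - u j)) (fun j => - b j)
    (fun j => - u0 j).
- by under eq_fun do rewrite opprK.
- by move=> u Pu j; rewrite lerNr; exact: Pb Pu j.
- move=> w v Pw wv; apply: (Pcl (fun k j => - w k j)) => // j.
  exact: cvgN.
- exists (fun j => - m j) => // u Pu um.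
  have <- : (fun j => - u j) = m.
    apply: mmax => [|j]; last by rewrite lerNr.
    by under eq_fun do rewrite opprK.
  by under [RHS]eq_fun do rewrite opprK.
Qed.

(** Every tail infimum is already 0: nonnegativity bounds it below, and values under any given [e]
    bound it above. *)
Lemma limn_einf_eq0 (R : realType) (D : R^nat) :
  (forall n, 0 <= D n) ->
  (forall e N, 0 < e -> ~ (forall n, (N <= n)%N -> e <= D n)) ->
  limn_einf (fun n => (D n)%:E) = 0%E.
Proof.
move=> D0 Dsmall; rewrite limn_einf_lim.
suff -> : einfs (fun n => (D n)%:E) = cst 0%E by exact: lim_cst.
apply/funext => N; apply/eqP; rewrite eq_le /=; apply/andP; split.
- apply/lee_addgt0Pr => e e0; rewrite add0e.
  have /existsNP[n /not_implyP[Nn /negP]] := Dsmall e N e0.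
  rewrite -ltNge => /ltW De.
  by apply: ge_ereal_inf; exists (D n)%:E; [exists n|rewrite lee_fin].
- by apply/ereal_infP => _ [n _ <-]; rewrite lee_fin.
Qed.

(** * Perturbation of a single term, and sequences in the cone *)

Definition spike (R : realType) (M : nat) (d : R) : R^nat :=
  fun j => if j == M then d else 0.

Lemma sum_add_spike (R : realType) (u : R^nat) M (d : R) n :
  \sum_(0 <= j < n) (u j + spike M d j) =
  \sum_(0 <= j < n) u j + if (M < n)%N then d else 0.
Proof.
elim: n => [|n IHn]; first by rewrite !big_nil addr0.
rewrite !big_nat_recr //= IHn /spike.
have [->|nM] := eqVneq n M; first by rewrite ltnn ltnSn; lra.
have -> : (M < n.+1)%N = (M < n)%N by rewrite ltnS leq_eqVlt eq_sym (negPf nM).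
lra.
Qed.

Lemma add_spike_neq (R : realType) (u : R^nat) M (d : R) :
  (fun j => u j + spike M d j) = u -> d = 0.
Proof. by move=> /(congr1 (@^~ M)); rewrite /spike eqxx; lra. Qed.

Lemma cvg_sum_seq (R : realType) (w : nat -> R^nat) (v : R^nat) n :
  (forall j, w k j @[k --> \oo] --> v j) ->
  \sum_(0 <= j < n) w k j @[k --> \oo] --> \sum_(0 <= j < n) v j.
Proof. by move=> wv; apply: cvg_big => [|j _]; [exact: add_continuous|]. Qed.

Lemma cvg0_constant_from (R : realType) (u : R^nat) k :
  u @ \oo --> 0 -> (forall M, (k <= M)%N -> u M.+1 = u M) ->
  forall M, (k <= M)%N -> u M = 0.
Proof.
move=> u0 ucst.
have uk M : (k <= M)%N -> u M = u k.
  elim: M => [|M IHM]; first by rewrite leqn0 => /eqP ->.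
  by rewrite leq_eqVlt => /predU1P[->//|kM]; rewrite ucst ?IHM.
suff -> : 0 = u k by [].
apply: (cvg_unique _ u0) => //.
apply: cvg_near_cst; exists k => // M /= kM; exact/eqP/uk.
Qed.

Lemma co_star_le (R : realType) (u v : R^nat) :
  (forall n, 0 <= u n) -> nonincreasing_seq u -> (forall n, u n <= v n) ->
  co_star v -> co_star u.
Proof.
move=> u0 umon uv [_ _ vcvg]; split => //.
apply: (@squeeze_cvgr _ _ _ _ (fun=> 0) v) => //; last exact: cvg_cst.
by apply: nearW => n; rewrite u0 uv.
Qed.

(* The nth term is at most the mean of the first terms, so Cesaro applies. *)
Lemma co_star_majorized (R : realType) (u v : R^nat) :
  (forall n, 0 <= u n) -> nonincreasing_seq u -> majorized u v ->
  co_star v -> co_star u.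
Proof.
move=> u0 umon uv [_ _ vcvg]; split => //.
apply: (@squeeze_cvgr _ _ _ _ (fun=> 0) (arithmetic_mean v)).
- apply: nearW => n; rewrite u0 /= /arithmetic_mean /series /=.
  rewrite ler_pdivlMl // (le_trans _ (uv n.+1)) //.
  have -> : n.+1%:R * u n = \sum_(0 <= j < n.+1) u n.
    by rewrite sumr_const_nat subn0 mulr_natl.
  by apply: ler_sum_nat => j /= jn; exact: umon.
- exact: cvg_cst.
- exact: cesaro.
Qed.

Lemma strongly_majorizedP (R : realType) (u v : R^nat) :
  majorized u v ->
  (forall e N, 0 < e -> ~ (forall n, (N <= n)%N ->
     e <= \sum_(0 <= j < n) v j - \sum_(0 <= j < n) u j)) ->
  strongly_majorized u v.
Proof.
move=> uv H; split => //.
under eq_fun do rewrite sumrB.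
by apply: limn_einf_eq0 => // n; rewrite subr_ge0.
Qed.

(** * Lowering [eta]: a minimal [zeta] *)

Lemma exists_strongly_majorizing_le (R : realType) (xi eta : R^nat) :
  co_star xi -> co_star eta -> majorized xi eta ->
  exists zeta : R^nat, [/\ co_star zeta, strongly_majorized xi zeta
       & forall n : nat, zeta n <= eta n].
Proof.
move=> [xi0 _ _] heta hmaj.
(* Each condition is a family of weak inequalities between finitely many terms, hence passes to
   pointwise limits; convergence to 0 comes afterwards from [co_star_le]. *)
pose P : set (R^nat) := [set u | [/\ forall n, 0 <= u n,
  forall n, u n.+1 <= u n, majorized xi u & forall n, u n <= eta n]].
have [|||z [z0 zmon xiz zeta] zmin] := @exists_minimal_seq R P (fun=> 0) eta.
- by case: heta => eta0 /nonincreasing_seqP etamon _; split.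
- by move=> u [].
- move=> w v Pw wv; split=> n.
  + apply: (ler_cvg_to (cvg_cst _) (wv n)).
    by apply: nearW => k; case: (Pw k).
  + apply: (ler_cvg_to (wv n.+1) (wv n)).
    by apply: nearW => k; case: (Pw k).
  + apply: (ler_cvg_to (cvg_cst _) (cvg_sum_seq wv)).
    by apply: nearW => k; case: (Pw k).
  + apply: (ler_cvg_to (wv n) (cvg_cst _)).
    by apply: nearW => k; case: (Pw k).
have zco : co_star z.
  by apply: co_star_le heta => //; exact/nonincreasing_seqP.
exists z; split => //; apply: strongly_majorizedP => // e N e0.
(* While the gap stays above e beyond M, minimality forbids a drop of z after
   M: otherwise z M could be lowered. *)
have nodrop M : (forall n, (M < n)%N ->
    e <= \sum_(0 <= j < n) z j - \sum_(0 <= j < n) xi j) -> z M.+1 = z M.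
  move=> He; apply/eqP; rewrite eq_le zmon leNgt; apply/negP => drop.
  (* The bound by [e] preserves the majorization of [xi]; the bound by the drop preserves
     monotonicity and, as [z M.+1] is nonnegative, the sign. *)
  pose d := Num.min e (z M - z M.+1).
  have d0 : 0 < d by rewrite lt_min e0 subr_gt0.
  have [de dz] : d <= e /\ d <= z M - z M.+1.
    by split; rewrite ge_min lexx ?orbT.
  have zS := z0 M.+1.
  suff /zmin H : P (fun j => z j + spike M (- d) j).
    have := @add_spike_neq R z M (- d); rewrite H; last first.
      by move=> j; rewrite /spike; case: eqP => _; lra.
    by move=> /(_ erefl); lra.
  split=> n.
  + by rewrite /spike; case: eqP => [->|_]; [lra|rewrite addr0].
  + rewrite /spike; have := zmon n; case: (eqVneq n M) => [->|nM].
      by case: eqP => _; lra.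
    by case: eqP => _; lra.
  + rewrite sum_add_spike; case: ifP => Mn; last by rewrite addr0.
    by have := He n Mn; lra.
  + by rewrite /spike; have := zeta n; case: eqP => _; lra.
elim: N => [|k IHk] He; first by have := He 0%N isT; rewrite !big_nil; lra.
(* With [z k] zero, passing from [k.+1] down to [k] changes the gap by [+ xi k], so the bound [e]
   extends to [k]. *)
have zk : z k = 0.
  apply: (@cvg0_constant_from _ z k) => //; first by case: zco.
  by move=> M kM; apply: nodrop => n Mn; apply: He; apply: leq_ltn_trans Mn.
apply: IHk => n; rewrite leq_eqVlt => /predU1P[<-|]; last exact: He.
have := He k.+1 (leqnn _); rewrite !big_nat_recr //= zk; have := xi0 k; lra.
Qed.

(** * Raising [xi]: a maximal [rho] *)

Lemma exists_ge_strongly_majorized (R : realType) (xi eta : R^nat) :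
  co_star xi -> co_star eta -> majorized xi eta ->
  exists rho : R^nat, [/\ co_star rho, forall n : nat, xi n <= rho n
       & strongly_majorized rho eta].
Proof.
move=> [xi0 ximon _] heta hmaj.
have [eta0 /nonincreasing_seqP etamon _] := heta.
pose P : set (R^nat) := [set u | [/\ forall n, xi n <= u n,
  forall n, u n.+1 <= u n & majorized u eta]].
(* A term of a nonnegative sequence is at most the partial sum ending with it, which gives the upper
   bound. *)
have [|||r [xir rmon reta] rmax] :=
    @exists_maximal_seq R P (fun n => \sum_(0 <= j < n.+1) eta j) xi.
- by split => //; exact/nonincreasing_seqP.
- move=> u [xiu _ ueta] n; apply: le_trans (ueta n.+1).
  rewrite big_nat_recr //= lerDr; apply: sumr_ge0 => j _.
  exact: le_trans (xi0 j) (xiu j).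
- move=> w v Pw wv; split=> n.
  + apply: (ler_cvg_to (cvg_cst _) (wv n)).
    by apply: nearW => k; case: (Pw k).
  + apply: (ler_cvg_to (wv n.+1) (wv n)).
    by apply: nearW => k; case: (Pw k).
  + apply: (ler_cvg_to (cvg_sum_seq wv) (cvg_cst _)).
    by apply: nearW => k; case: (Pw k).
have r0 n : 0 <= r n by exact: le_trans (xi0 n) (xir n).
have rco : co_star r.
  by apply: co_star_majorized heta => //; exact/nonincreasing_seqP.
exists r; split => //; apply: strongly_majorizedP => // e N.
pose D n := \sum_(0 <= j < n) eta j - \sum_(0 <= j < n) r j.
have D0 n : 0 <= D n by rewrite subr_ge0.
have DS n : D n.+1 = D n + (eta n - r n).
  by rewrite /D !big_nat_recr //=; lra.
(* Raising [r M] by [d] keeps [r] nonincreasing if the preceding term leaves room; index 0 has no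
   preceding term, hence the case split. *)
have raise M d : 0 < d -> (forall n, (M < n)%N -> d <= D n) ->
    (if M is k.+1 then d <= r k - r M else true) -> False.
  move=> d0 He hM.
  suff /rmax H : P (fun j => r j + spike M d j).
    have := @add_spike_neq R r M d; rewrite H; last first.
      by move=> j; rewrite /spike; case: eqP => _; lra.
    by move=> /(_ erefl); lra.
  split=> n.
  + by rewrite /spike; have := xir n; case: eqP => _; lra.
  + rewrite /spike; have := rmon n; case: (eqVneq n.+1 M) => [nM|_].
      by move: hM; rewrite -nM; case: eqP => _; lra.
    by case: eqP => _; lra.
  + rewrite sum_add_spike; case: ifP => Mn; last by rewrite addr0; exact: reta.
    by have := He n Mn; rewrite /D; lra.
have norise e' M : 0 < e' -> (forall n, (M.+1 < n)%N -> e' <= D n) ->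
    r M.+1 = r M.
  move=> e0 He; apply/eqP; rewrite eq_le rmon leNgt; apply/negP => drop.
  apply: (@raise M.+1 (Num.min e' (r M - r M.+1))).
  - by rewrite lt_min e0 subr_gt0.
  - by move=> n /He; rewrite ge_min => ->.
  - by rewrite ge_min lexx orbT.
(* [e] is generalized because the descent only gives some positive gap at the new index, possibly
   below [e]. *)
elim: N e => [|k IHk] e e0 He.
  by have := He 0%N isT; rewrite !big_nil; lra.
(* A gap of [e] from index 1 on lets the first term be raised. Otherwise the gap holds from [k.+2]
   on, which excludes drops from [k] on. *)
case: k IHk He => [|k] IHk He; first exact: (@raise 0%N e).
have rk M : (k <= M)%N -> r M = 0.
  apply: cvg0_constant_from => [|{}M kM]; first by case: rco.
  by apply: (norise e) => // n Mn; apply: He; apply: leq_ltn_trans Mn.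
(* From k on r vanishes, so D is nondecreasing; if D k.+1 were 0 then so would
   be eta k, hence eta k.+1 and D k.+2. *)
have Dk : 0 < D k.+1.
  rewrite lt_neqAle D0 andbT; apply/negP => /eqP Dk0.
  have := He k.+2 (leqnn _); rewrite -/(D _) DS -Dk0 rk //.
  move: Dk0; rewrite DS (rk k) //.
  by have := D0 k; have := eta0 k; have := etamon k; lra.
apply: (IHk (Num.min e (D k.+1))); first by rewrite lt_min e0.
move=> n; rewrite leq_eqVlt => /predU1P[<-|kn]; rewrite ge_min.
  by rewrite lexx orbT.
by rewrite He.
Qed.

Theorem theorem7p4 (R : realType) (xi eta : R^nat)
    (hxi : co_star xi) (heta : co_star eta) (hmaj : majorized xi eta) :
  (exists zeta : R^nat,
     [/\ co_star zeta, strongly_majorized xi zeta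
       & forall n : nat, zeta n <= eta n]) /\
  (exists rho : R^nat,
     [/\ co_star rho, forall n : nat, xi n <= rho n
       & strongly_majorized rho eta]).
Proof.
split; first exact: exists_strongly_majorizing_le.
exact: exists_ge_strongly_majorized.
Qed.
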